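(* Let $N$ be odd, let $1\le L\le N$ be an integer, let $A=\sigma_1^{\alpha_1}\sigma_2^{\alpha_2}\cdots\sigma_L^{\alpha_L}$ with $\alpha_1,\dots,\alpha_L\in\{0,x,y,z\}$ be a product of Pauli operators on the ring of $N$ spins, let $|\boldsymbol\beta_1\rangle,|\boldsymbol\beta_2\rangle$ be two product states of $\sigma^x$-eigenvectors, let $p_1,p_2\in\{2\pi k/N:k=0,1,\dots,N-1\}$, and consider the states $|\boldsymbol\beta_1,p_1\rangle$ and $|\boldsymbol\beta_2,p_2\rangle$. There exist positive constants $C_1,C_2$, independent of $N$ and depending only on $L$ and on the numbers of ferromagnetic bonds in $|\boldsymbol\beta_1\rangle$ and $|\boldsymbol\beta_2\rangle$, such that: (a) Suppose $\alpha_j\in\{0,x\}$ for all $j\in\{1,\dots,L\}$, with $\alpha_j=x$ for an odd number of sites $j$. If $|\boldsymbol\beta_1\rangle$ and $|\boldsymbol\beta_2\rangle$ are different and not equivalent by translation, then $$\langle\boldsymbol\beta_1,p_1|A|\boldsymbol\beta_2,p_2\rangle=0 .$$ If $|\boldsymbol\beta_1\rangle=|\boldsymbol\beta_2\rangle$, then $$|\langle\boldsymbol\beta_1,p_1|A|\boldsymbol\beta_2,p_2\rangle|\le\frac{C_1}{N\left|\cos\frac{p_1-p_2}{2}\right|}.$$ (b) Suppose there is at least one site $j\in\{1,\dots,L\}$ with $\alpha_j\in\{y,z\}$. Then $$|\langle\boldsymbol\beta_1,p_1|A|\boldsymbol\beta_2,p_2\rangle|\le\frac{C_2}{N}.$$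
   Context: Consider a ring of $N$ spins $1/2$, $N$ odd, with Hilbert space $(\mathbb C^2)^{\otimes N}$. For $\alpha\in\{x,y,z\}$, $\sigma_j^\alpha$ denotes the Pauli matrix $\sigma^\alpha$ acting on the $j$-th tensor factor, with periodic indices $\sigma^\alpha_{j+N}=\sigma^\alpha_j$; $\sigma_j^0$ is the identity. Let $|\pm\rangle$ be the normalized eigenvectors of $\sigma^x$ with eigenvalues $\pm1$. A product state $|\boldsymbol\beta\rangle$ means $|\boldsymbol\beta\rangle=\bigotimes_{j=1}^N|\beta_j\rangle$ with each $|\beta_j\rangle\in\{|+\rangle,|-\rangle\}$. A ferromagnetic bond (kink) of $|\boldsymbol\beta\rangle$ is an index $j\in\{1,\dots,N\}$ with $\beta_j=\beta_{j+1}$ (indices mod $N$). The translation operator $T$ is the unitary cyclic shift by one site, $T(|\beta_1\rangle\otimes|\beta_2\rangle\otimes\cdots\otimes|\beta_N\rangle)=|\beta_2\rangle\otimes\cdots\otimes|\beta_N\rangle\otimes|\beta_1\rangle$, so that $T^\dagger\sigma_j^\alpha T=\sigma_{j+1}^\alpha$. Two product states $|\boldsymbol\beta_1\rangle,|\boldsymbol\beta_2\rangle$ are called not equivalent by translation if $|\boldsymbol\beta_1\rangle\ne T^k|\boldsymbol\beta_2\rangle$ for every integer $k$. For $p=2\pi k/N$, $k\in\{0,\dots,N-1\}$, define $$|\boldsymbol\beta,p\rangle=\frac1{\sqrt N}\sum_{j=0}^{N-1}e^{-\imath pj}\,T^j|\boldsymbol\beta\rangle .$$ Since $N$ is odd,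 $p_1-p_2$ is never an odd multiple of $\pi$, so $\cos\frac{p_1-p_2}{2}\neq0$. The constants $C_1,C_2$ are to be understood as functions of $L$ and of the two numbers of ferromagnetic bonds only, valid for all $N$, $A$, $\boldsymbol\beta_1,\boldsymbol\beta_2$, $p_1,p_2$ with these data. *)

(* Defs.v *)
From HB Require Import structures.
From mathcomp Require Import all_boot all_order all_algebra.
From mathcomp Require Import reals trigo.
From mathcomp.real_closed Require Import complex.

Set Implicit Arguments.
Unset Strict Implicit.
Unset Printing Implicit Defensive.

Import Order.TTheory GRing.Theory Num.Theory.
Local Open Scope ring_scope.
Local Open Scope complex_scope.

Inductive pauli := P0 | Px | Py | Pz.

Definition pauli_eqb (a b : pauli) : bool :=
  match a, b with
  | P0, P0 | Px, Px | Py, Py | Pz, Pz => true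
  | _, _ => false
  end.

Lemma pauli_eqbP : Equality.axiom pauli_eqb.
Proof. by case; case; constructor. Qed.

HB.instance Definition _ := hasDecEq.Build pauli pauli_eqbP.

Section SpinRing.
Variable R : realType.

Definition mx2 (a b c d : R[i]) : 'M[R[i]]_2 :=
  \matrix_(i, j) if i == 0 then (if j == 0 then a else b)
                 else (if j == 0 then c else d).

Definition pauli_mx (a : pauli) : 'M[R[i]]_2 :=
  match a with
  | P0 => 1%:M
  | Px => mx2 0 1 1 0
  | Py => mx2 0 (- 'i) 'i 0
  | Pz => mx2 1 0 0 (-1)
  end.

(* |+> = ketx true and |-> = ketx false, in the basis of sigma^z and with the
   usual phases: |+-> = (1, +-1) / sqrt 2. *)
Definition ketx (b : bool) : 'cV[R[i]]_2 :=
  \col_i (((Num.sqrt (2 : R))^-1)%:C * (if (i == 0) || b then 1 else -1)).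

Lemma ketx_eigen (b : bool) :
  pauli_mx Px *m ketx b = (if b then 1 else -1) *: ketx b.
Proof.
apply/colP => i; rewrite !mxE !big_ord_recl big_ord0 !mxE /=.
by case: i => [[|[|//]] hi]; case: b;
  rewrite -!val_eqE /= ?(mul0r, mul1r, mulr1, mulN1r, mulrN1, add0r, addr0, opprK).
Qed.

Lemma ketx_normalized (b : bool) : \sum_i (ketx b i 0)^* * ketx b i 0 = 1.
Proof.
have hs : ((Num.sqrt (2 : R))^-1)%:C * ((Num.sqrt (2 : R))^-1)%:C = (2^-1)%:C.
  by rewrite -rmorphM /= -invfM -expr2 sqr_sqrtr ?ler0n.
have h1 : (2^-1 : R)%:C + (2^-1)%:C = 1.
  by rewrite -rmorphD /= -mulr2n -[_ *+ 2]mulr_natr mulVf ?pnatr_eq0.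
rewrite !big_ord_recl big_ord0 !mxE /= addr0.
have hc (x : R) : Num.conj x%:C = x%:C by exact: conjc_real.
by case: b; rewrite ?rmorphM ?rmorphN ?rmorph1 /= hc ?mulr1 ?mulrN1 ?mulrNN hs.
Qed.

(* A vector of the N-fold tensor power of C^2 is the family of its components
   in the basis of the tensor products of vectors of the sigma^z basis. *)
Definition config (N : nat) := {ffun 'I_N -> 'I_2}.
Definition hilb (N : nat) := {ffun config N -> R[i]}.

Definition tensor N (phi : 'I_N -> 'cV[R[i]]_2) : hilb N :=
  [ffun s : config N => \prod_j phi j (s j) 0].

Definition product_state N (beta : {ffun 'I_N -> bool}) : hilb N :=
  tensor (fun j => ketx (beta j)).

Definition braket N (u v : hilb N) : R[i] := \sum_s (u s)^* * v s.

Definition set_site N (s : config N) (j : 'I_N) (t : 'I_2) : config N :=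
  [ffun i => if i == j then t else s i].

Definition sigma N (a : pauli) (j : 'I_N) (v : hilb N) : hilb N :=
  [ffun s : config N => \sum_t pauli_mx a (s j) t * v (set_site s j t)].

Lemma sigma_tensor N (a : pauli) (j : 'I_N) (phi : 'I_N -> 'cV[R[i]]_2) :
  sigma a j (tensor phi) =
  tensor (fun i => if i == j then pauli_mx a *m phi i else phi i).
Proof.
apply/ffunP => s; rewrite !ffunE (bigD1 j) //= eqxx mxE big_distrl /=.
apply: eq_bigr => t _; rewrite ffunE (bigD1 j) //= ffunE eqxx mulrA.
by congr (_ * _); apply: eq_bigr => i /negPf nij; rewrite ffunE nij.
Qed.

(* The sites are numbered from 0, so that the first L sites are the image of
   'I_L in 'I_N. *)
Definition pauli_string N L (hLN : (L <= N)%N) (alpha : 'I_L -> pauli) :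
    hilb N -> hilb N :=
  \big[comp/id]_(j < L) sigma (alpha j) (widen_ord hLN j).

Definition transl N (v : hilb N) : hilb N :=
  [ffun s : config N => v [ffun j => s (ord_pred j)]].

Definition translV N (v : hilb N) : hilb N :=
  [ffun s : config N => v [ffun j => s (ordS j)]].

Definition transl_pow N (k : int) : hilb N -> hilb N :=
  match k with
  | Posz n => iter n (@transl N)
  | Negz n => iter n.+1 (@translV N)
  end.

Lemma transl_tensor N (phi : 'I_N -> 'cV[R[i]]_2) :
  transl (tensor phi) = tensor (fun j => phi (ordS j)).
Proof.
apply/ffunP => s; rewrite !ffunE.
rewrite (reindex_inj (can_inj (@ordSK N))) /=.
by apply: eq_bigr => j _; rewrite ffunE ordSK.
Qed.

Lemma translK N : cancel (@transl N) (@translV N).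
Proof.
move=> v; apply/ffunP => s; rewrite !ffunE; congr (v _).
by apply/ffunP => j; rewrite !ffunE ord_predK.
Qed.

Lemma translVK N : cancel (@translV N) (@transl N).
Proof.
move=> v; apply/ffunP => s; rewrite !ffunE; congr (v _).
by apply/ffunP => j; rewrite !ffunE ordSK.
Qed.

Lemma sigma_transl N (a : pauli) (j : 'I_N) (v : hilb N) :
  translV (sigma a j (transl v)) = sigma a (ordS j) v.
Proof.
apply/ffunP => s; rewrite !ffunE; apply: eq_bigr => t _.
rewrite !ffunE; congr (_ * v _).
apply/ffunP => i; rewrite !ffunE ord_predK.
by rewrite -(inj_eq (can_inj (@ordSK N))) ord_predK.
Qed.

Definition transl_equiv N (u v : hilb N) : Prop :=
  exists k : int, u = transl_pow k v.

Definition kinks N (beta : {ffun 'I_N -> bool}) : nat :=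
  #|[set j | beta j == beta (ordS j)]|.

Definition is_momentum (N : nat) (p : R) : Prop :=
  exists k : 'I_N, p = 2 * pi * k%:R / N%:R.

Definition expi (x : R) : R[i] := cos x +i* sin x.

Definition momentum_state N (beta : {ffun 'I_N -> bool}) (p : R) : hilb N :=
  [ffun s => ((Num.sqrt (N%:R : R))^-1)%:C *
    \sum_(j < N) expi (- (p * j%:R)) *
                 transl_pow (Posz j) (product_state beta) s].

End SpinRing.

(* Main.v *)
(* Expanding both momentum states gives M = 1/N times a double sum over
   translations (j, k) of a phase times <T^j beta1|A|T^k beta2>, and A maps a
   product state to a unimodular multiple of another one, flipped at the sites
   carrying sigma^y or sigma^z.  Since N is odd every beta has a kink, and the
   position of a kink determines a translation: T^j beta = beta' has at most
   [kinks beta] solutions j.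
   (b) If L < N, the last bond of the flipped set is a kink of exactly one of
   T^j beta1 and T^k beta2, which leaves at most 2 n1 n2 pairs (j, k); if L = N
   there are only L^2 pairs in all.
   (a) Without flips, let a_k be the sign of the string on T^k beta.  Multiplying
   the double sum by 1 + e^{i(p1-p2)}, of modulus 2|cos((p1-p2)/2)|, replaces a_k
   by a_k + a_{k+1}, which vanishes unless a kink of T^k beta sits on the string,
   because the number of sigma^x is odd. *)
Require Import Defs.
From mathcomp Require Import all_boot all_order all_algebra.
From mathcomp Require Import reals trigo ring.
From mathcomp.real_closed Require Import complex.
Import Order.TTheory GRing.Theory Num.Theory.
Local Open Scope ring_scope.
Local Open Scope complex_scope.

Set Implicit Arguments.
Unset Strict Implicit.
Unset Printing Implicit Defensive.

(** * Sesquilinear expansion and product operators acting on tensors *)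

Section Linearity.
Variables (R : realType) (N : nat).

(** Momentum states are superpositions of product states; with index type ['I_1] the same form
    carries a single scalar factor. *)
Definition lcomb (I : finType) (a : I -> R[i]) (u : I -> hilb R N) : hilb R N :=
  [ffun s => \sum_j a j * u j s].

Lemma sigma_lcomb (I : finType) (a : I -> R[i]) (u : I -> hilb R N) b j :
  sigma b j (lcomb a u) = lcomb a (fun i => sigma b j (u i)).
Proof.
apply/ffunP => s; rewrite !ffunE.
under eq_bigr => t _ do rewrite ffunE big_distrr /=.
rewrite exchange_big /=; apply: eq_bigr => i _.
rewrite ffunE big_distrr /=; apply: eq_bigr => t _; exact: mulrCA.
Qed.

Lemma pauli_string_lcomb L (hLN : (L <= N)%N) (alpha : 'I_L -> pauli)
    (I : finType) (a : I -> R[i]) (u : I -> hilb R N) :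
  pauli_string hLN alpha (lcomb a u) =
  lcomb a (fun i => pauli_string hLN alpha (u i)).
Proof.
rewrite /pauli_string; elim: (index_enum _) => [|j r IH].
  by rewrite big_nil /=; apply/ffunP => s; rewrite !ffunE.
by rewrite big_cons /= IH sigma_lcomb.
Qed.

Lemma braket_lcomb (I J : finType) (a : I -> R[i]) (b : J -> R[i])
    (u : I -> hilb R N) (v : J -> hilb R N) :
  braket (lcomb a u) (lcomb b v) =
  \sum_i \sum_j (a i)^* * b j * braket (u i) (v j).
Proof.
rewrite /braket.
transitivity (\sum_s \sum_i \sum_j ((a i)^* * b j) * ((u i s)^* * v j s)).
  apply: eq_bigr => s _; rewrite !ffunE rmorph_sum /= mulr_suml.
  apply: eq_bigr => i _; rewrite mulr_sumr; apply: eq_bigr => j _.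
  by rewrite rmorphM /= mulrACA.
rewrite exchange_big /=; apply: eq_bigr => i _.
rewrite exchange_big /=; apply: eq_bigr => j _.
by rewrite mulr_sumr.
Qed.

Lemma eq_tensor (phi psi : 'I_N -> 'cV[R[i]]_2) :
  phi =1 psi -> tensor phi = tensor psi.
Proof.
by move=> h; apply/ffunP => s; rewrite !ffunE; apply: eq_bigr => j _; rewrite h.
Qed.

Lemma tensorZ (c : 'I_N -> R[i]) (phi : 'I_N -> 'cV[R[i]]_2) s :
  tensor (fun j => c j *: phi j) s = (\prod_j c j) * tensor phi s.
Proof.
by rewrite !ffunE -big_split /=; apply: eq_bigr => j _; rewrite mxE.
Qed.

Lemma braket_tensor (phi psi : 'I_N -> 'cV[R[i]]_2) :
  braket (tensor phi) (tensor psi) =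
  \prod_j \sum_t (phi j t 0)^* * psi j t 0.
Proof.
rewrite bigA_distr_bigA /=; apply: eq_bigr => s _.
by rewrite !ffunE rmorph_prod -big_split.
Qed.

(** Padding with [P0] beyond the first [L] sites lets products run over the whole ring. *)
Definition ext_pauli L (alpha : 'I_L -> pauli) (i : 'I_N) : pauli :=
  if insub (val i) is Some j then alpha j else P0.

Lemma ext_pauli_widen L (hLN : (L <= N)%N) (alpha : 'I_L -> pauli) j :
  ext_pauli alpha (widen_ord hLN j) = alpha j.
Proof. by rewrite /ext_pauli /= valK. Qed.

Lemma pauli_string_tensor L (hLN : (L <= N)%N) (alpha : 'I_L -> pauli)
    (phi : 'I_N -> 'cV[R[i]]_2) :
  pauli_string hLN alpha (tensor phi) =
  tensor (fun i => pauli_mx R (ext_pauli alpha i) *m phi i).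
Proof.
have widen_inj : injective (widen_ord hLN).
  by move=> i j /(congr1 val) /= h; apply: val_inj.
(* Induction on the list of factors applied: sites outside the list still carry the identity, and
   [uniq] ensures that no site is hit twice. *)
suff H r : uniq r ->
    (\big[comp/id]_(j <- r) @sigma R N (alpha j) (widen_ord hLN j)) (tensor phi) =
    tensor (fun i => pauli_mx R (if i \in map (widen_ord hLN) r
                                 then ext_pauli alpha i else P0) *m phi i).
  rewrite /pauli_string H ?index_enum_uniq //; apply: eq_tensor => i.
  case: ifP => // /negbT hi; congr (pauli_mx _ _ *m _).
  rewrite /ext_pauli; case: insubP => // j _ hj; case/negP: hi.
  by apply/mapP; exists j; [exact: mem_index_enum | exact: val_inj].
elim: r => [_|j r IH] /=.
  by rewrite big_nil; apply: eq_tensor => i /=; rewrite mul1mx.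
case/andP => jr ur; rewrite big_cons /= IH // sigma_tensor.
apply: eq_tensor => i; rewrite inE; case: eqP => [->|_] //=.
by rewrite mem_map // (negbTE jr) mul1mx ext_pauli_widen.
Qed.

End Linearity.

(** * Pauli matrices in the eigenbasis of sigma^x *)

Section SingleSite.
Variable R : realType.

Definition flips (a : pauli) : bool := a \in [:: Py; Pz].

Definition pauli_coef (a : pauli) (b : bool) : R[i] :=
  match a with
  | P0 => 1
  | Px => if b then 1 else -1
  | Py => if b then - 'i else 'i
  | Pz => 1
  end.

Lemma pauli_ketx a b :
  pauli_mx R a *m ketx R b = pauli_coef a b *: ketx R (b (+) flips a).
Proof.
case: a.
- by rewrite /= mul1mx scale1r addbF.
- by rewrite ketx_eigen addbF.
all: apply/colP => i; rewrite !mxE !big_ord_recl big_ord0 !mxE /=.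
all: case: i => [[|[|//]] hi]; case: b;
  rewrite -!val_eqE /= ?(mul0r, mul1r, mulr1, mulN1r, mulrN1, add0r, addr0, opprK, mulNr, mulrN) //.
Qed.

Lemma norm_pauli_coef a b : `|pauli_coef a b| = 1.
Proof.
have ni : `|'i : R[i]| = 1.
  by rewrite normc_def /= expr0n /= add0r expr1n sqrtr1.
by case: a; case: b; rewrite /= ?normrN ?normr1.
Qed.

Lemma ketx_orthonormal b b' :
  \sum_t (ketx R b t 0)^* * ketx R b' t 0 = (b == b')%:R.
Proof.
case: eqP => [<-|/eqP]; first exact: ketx_normalized.
have hc (x : R) : Num.conj x%:C = x%:C by exact: conjc_real.
by rewrite !big_ord_recl big_ord0 !mxE /=; case: b; case: b' => //= _;
  rewrite ?rmorphM ?rmorphN ?rmorph1 /= hc ?mulr1 ?mulrN1 ?mulrNN ?mulrN ?mulNr addr0 ?subrr ?addNr.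
Qed.

Lemma braket_product_state N (b b' : {ffun 'I_N -> bool}) :
  braket (product_state R b) (product_state R b') = (b == b')%:R.
Proof.
rewrite braket_tensor; case: (altP eqP) => [->|/eqP nb].
  by rewrite big1 // => j _; rewrite ketx_orthonormal eqxx.
case: (altP (@forallP _ (fun j => b j == b' j))) => [h|].
  by case: nb; apply/ffunP => j; apply/eqP.
rewrite negb_forall => /existsP [j /negbTE hj].
by rewrite (bigD1 j) //= ketx_orthonormal hj mul0r.
Qed.

(** Orthonormality turns an equality of state vectors, as in part (a), into one of sign patterns. *)
Lemma product_state_inj N : injective (@product_state R N).
Proof.
move=> b b' h; apply/eqP; have := braket_product_state b b'.
rewrite h braket_product_state eqxx; case: eqP => // _ /eqP.
by rewrite oner_eq0.
Qed.

Lemma pauli_string_product_state N L (hLN : (L <= N)%N) (alpha : 'I_L -> pauli)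
    (b : {ffun 'I_N -> bool}) s :
  pauli_string hLN alpha (product_state R b) s =
  (\prod_i pauli_coef (ext_pauli alpha i) (b i)) *
  product_state R [ffun i => b i (+) flips (ext_pauli alpha i)] s.
Proof.
rewrite pauli_string_tensor -tensorZ; congr (fun_of_fin _ s).
by apply: eq_tensor => i; rewrite ffunE pauli_ketx.
Qed.

End SingleSite.

(** * Phases and lattice momenta *)

Section Characters.
Variable R : realType.

Lemma expiD (x y : R) : expi (x + y) = expi x * expi y.
Proof. by rewrite /expi cosD sinD; congr (_ +i* _); rewrite // addrC mulrC. Qed.

Lemma expi0 : expi (0 : R) = 1.
Proof. by rewrite /expi cos0 sin0. Qed.

Lemma norm_expi (x : R) : `|expi x| = 1.
Proof. by rewrite normc_def /= cos2Dsin2 sqrtr1. Qed.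

Lemma conj_expi (x : R) : (expi x)^* = expi (- x).
Proof. by rewrite /expi cosN sinN. Qed.

Lemma expi_momentum N (p : R) m : (0 < N)%N ->
  is_momentum N p -> expi (p * (N * m)%:R) = 1.
Proof.
move=> N0 [k ->].
have -> : 2 * pi * k%:R / N%:R * (N * m)%:R = pi *+ (k * m).*2 :> R.
  rewrite natrM mulrA divfK ?pnatr_eq0 -?lt0n //.
  by rewrite -muln2 -[RHS]mulr_natr !natrM; ring.
elim: (k * m)%N => [|j IH]; first by rewrite mulr0n expi0.
by rewrite doubleS !mulrSr -addrA expiD IH mul1r -mulr2n /expi cos2pi sin2pi.
Qed.

(** Momentum phases depend on the site modulo [N] only, so they are characters of Z/N. *)
Lemma expi_modn N (p : R) m : (0 < N)%N -> is_momentum N p ->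
  expi (- (p * (m %% N)%:R)) = expi (- (p * m%:R)).
Proof.
move=> N0 hp; rewrite {2}(divn_eq m N) natrD mulrDr opprD expiD mulnC.
by rewrite -[in RHS]conj_expi expi_momentum // rmorph1 mul1r.
Qed.

Lemma norm_1Dexpi (q : R) : `|1 + expi q| = (2 * `|cos (q / 2)|)%:C.
Proof.
(* Half-angle factorisation: 1 + e^{iq} = 2 cos(q/2) e^{iq/2}. *)
have -> : 1 + expi q = (2 * cos (q / 2))%:C * expi (q / 2).
  rewrite {1}[q](_ : _ = q / 2 *+ 2); last by rewrite -mulr_natr divfK ?pnatr_eq0.
  rewrite /expi cos_mulr2n sin_mulr2n; apply/eqP; rewrite eq_complex /=.
  apply/andP; split; apply/eqP.
    by rewrite mul0r subr0 addrCA subrr addr0 -mulrA -expr2 mulr_natl.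
  by rewrite mul0r addr0 add0r mulrC -mulrA [_ * sin _]mulrC mulr_natl.
rewrite normrM norm_expi mulr1 normc_def /= expr0n /= addr0 sqrtr_sqr.
by rewrite normrM ger0_norm.
Qed.

End Characters.

(** * Translations of sign patterns and counting by kinks *)

Section Rotations.
Variable n : nat.
Local Notation G := 'I_n.+1.
Implicit Types (b : {ffun G -> bool}) (i j k : G).

Definition rot b k : {ffun G -> bool} := [ffun i => b (i + k)].
(** Written with [inZp] so that the ring of a single site, where it is 0, is covered as well. *)
Definition unit_site : G := inZp 1.
Local Notation e := unit_site.

Lemma ordS_add i : ordS i = i + e.
Proof. by apply: val_inj; rewrite /= modnDmr addn1. Qed.

Lemma rotD b j k : rot (rot b j) k = rot b (j + k).
Proof. by apply/ffunP => i; rewrite !ffunE addrAC addrA. Qed.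

Lemma rot0 b : rot b 0 = b.
Proof. by apply/ffunP => i; rewrite ffunE addr0. Qed.

Lemma rot_shift b b' j k l : (rot b (j + l) == rot b' (k + l)) = (rot b j == rot b' k).
Proof.
apply/eqP/eqP => [h|h]; last by rewrite -!rotD h.
by rewrite -[j](addrK l) -[k](addrK l) -!(rotD _ (_ + l)) h.
Qed.

Definition kink b i : bool := b i == b (i + e).

Lemma kinksE b : kinks b = #|[set j | kink b j]|.
Proof. by apply: eq_card => j; rewrite !inE ordS_add. Qed.

Lemma kink_rot b i j : kink (rot b j) i = kink b (i + j).
Proof. by rewrite /kink !ffunE addrAC. Qed.

Lemma card_kink_shift b i : #|[set k | kink b (i + k)]| = kinks b.
Proof.
rewrite kinksE -[RHS](card_preimset _ (addrI i)).
by apply: eq_card => j; rewrite !inE.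
Qed.

(** Without kinks the signs alternate, and after an odd number of steps around the ring a sign would
    equal its own negation. *)
Lemma kink_exists b : odd n.+1 -> exists i, kink b i.
Proof.
move=> oddn; have [i hi|h] := pickP (kink b); first by exists i.
have step m : b (inZp m.+1) = ~~ b (inZp m).
  have := h (inZp m); rewrite /kink.
  have -> : inZp m + e = inZp m.+1 :> G by apply: val_inj; rewrite /= modnDm addn1.
  by case: (b _); case: (b _).
have all m : b (inZp m) = b (inZp 0) (+) odd m.
  by elim: m => [|m IH]; rewrite ?addbF // step IH /= addbN.
have := all n.+1; rewrite oddn.
have -> : inZp n.+1 = inZp 0 :> G by apply: val_inj; rewrite /= modnn mod0n.
by case: (b _).
Qed.

(** One solution [j0] moves a kink [i0] of [b] to the bond [i0 - j0] of [b']. Any solution [j] must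
    then bring some kink of [b] to that same bond, and this kink determines [j]. *)
Lemma card_rot_eq b b' : odd n.+1 -> (#|[set j | rot b j == b']| <= kinks b)%N.
Proof.
move=> oddn; have [->|[j0]] := set_0Vmem [set j | rot b j == b'].
  by rewrite cards0.
rewrite inE => /eqP h0; have [i0 hi0] := kink_exists b oddn.
rewrite -(card_kink_shift b (i0 - j0)); apply/subset_leq_card/subsetP => j.
by rewrite !inE => /eqP hj; rewrite -kink_rot hj -h0 kink_rot subrK.
Qed.

Definition flipmask (S : {set G}) b : {ffun G -> bool} := [ffun i => b i (+) (i \in S)].

Lemma flipmaskK S : involutive (flipmask S).
Proof. by move=> b; apply/ffunP => i; rewrite !ffunE addbK. Qed.

(** The mask flips exactly one end of the bond from [i] to [i + e], so this bond is a kink of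
    exactly one of the two rotated patterns. Each matching pair is charged to that kink. *)
Lemma card_flip_pairs (S : {set G}) b1 b2 i : odd n.+1 ->
    i \in S -> i + e \notin S ->
  (\sum_j \sum_k (rot b1 j == flipmask S (rot b2 k)) <= 2 * (kinks b1 * kinks b2))%N.
Proof.
move=> oddn iS eS; pose D j k := rot b1 j == flipmask S (rot b2 k).
have split_kink j k : (D j k <= kink b1 (i + j)%R * D j k + kink b2 (i + k)%R * D j k)%N.
  rewrite /D; case: eqP => //= h; rewrite !muln1.
  have : kink b1 (i + j)%R (+) kink b2 (i + k)%R.
    rewrite -!kink_rot h /kink !ffunE iS (negbTE eS).
    by case: (b2 _); case: (b2 _).
  by case: (kink _ _); case: (kink _ _).
apply: (@leq_trans (\sum_j \sum_k kink b1 (i + j)%R * D j k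
                  + \sum_j \sum_k kink b2 (i + k)%R * D j k)%N).
  rewrite -big_split /=; apply: leq_sum => j _; rewrite -big_split /=.
  by apply: leq_sum => k _; exact: split_kink.
(* In the first sum, [kinks b1] values of [j] put a kink at [i], and [card_rot_eq] leaves at most
   [kinks b2] values of [k] for each. The second sum is symmetric. *)
rewrite mul2n -addnn; apply: leq_add.
  rewrite -(card_kink_shift b1 i) -sum1_card big_distrl /= [leqRHS]big_mkcond.
  apply: leq_sum => j _; rewrite inE -big_distrr /= mul1n; case: ifP => //= _.
  rewrite mul1n; apply: leq_trans (card_rot_eq b2 (flipmask S (rot b1 j)) oddn).
  rewrite -sum1_card [leqRHS]big_mkcond /=; apply: leq_sum => k _.
  by rewrite inE /D [rot b1 j == _]eq_sym (inv_eq (flipmaskK S)); case: (_ == _).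
rewrite exchange_big /= mulnC.
rewrite -(card_kink_shift b2 i) -sum1_card big_distrl /= [leqRHS]big_mkcond.
apply: leq_sum => k _; rewrite inE -big_distrr /= mul1n; case: ifP => //= _.
rewrite mul1n; apply: leq_trans (card_rot_eq b1 (flipmask S (rot b2 k)) oddn).
rewrite -sum1_card [leqRHS]big_mkcond /=; apply: leq_sum => j _.
by rewrite inE /D; case: (_ == _).
Qed.

End Rotations.

(** * The matrix element as a double sum over translations *)

Section MatrixElement.
Variables (R : realType) (n : nat).
Local Notation G := 'I_n.+1.
Local Notation e := (unit_site n).
Implicit Types (b : {ffun G -> bool}) (i j k : G).

Lemma transl_pow_product_state b (m : nat) :
  transl_pow (Posz m) (product_state R b) = product_state R (rot b (inZp m)).
Proof.
rewrite /=; elim: m b => [|m IH] b.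
  by congr product_state; rewrite -[LHS]rot0; congr rot; apply: val_inj; rewrite /= mod0n.
rewrite iterS IH transl_tensor; apply: eq_tensor => j; congr (ketx _ _).
rewrite !ffunE ordS_add -addrA; congr (b (_ + _)).
by apply: val_inj; rewrite /= modnDm add1n.
Qed.

Definition chi (p : R) (j : G) : R[i] := expi (- (p * j%:R)).

Lemma momentum_stateE b p :
  momentum_state b p =
  lcomb (fun j => ((Num.sqrt (n.+1%:R : R))^-1)%:C * chi p j)
        (fun j => product_state R (rot b j)).
Proof.
apply/ffunP => s; rewrite !ffunE big_distrr /=; apply: eq_bigr => j _.
rewrite -mulrA; congr (_ * (_ * _)).
by rewrite -[iter _ _ _]/(transl_pow (Posz j) _) transl_pow_product_state valZpK.
Qed.

Lemma chiD p j k : is_momentum n.+1 p -> chi p (j + k) = chi p j * chi p k.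
Proof.
move=> hp; rewrite /chi [nat_of_ord (j + k)]/= (expi_modn _ (ltn0Sn n) hp).
by rewrite natrD mulrDr opprD expiD.
Qed.

Lemma chi_unit p : is_momentum n.+1 p -> chi p e = expi (- p).
Proof. by move=> hp; rewrite /chi /= (expi_modn _ (ltn0Sn n) hp) mulr1. Qed.

Definition string_coef (al : G -> pauli) b : R[i] := \prod_i pauli_coef R (al i) (b i).

Lemma norm_string_coef al b : `|string_coef al b| = 1.
Proof. by rewrite normr_prod big1 // => i _; rewrite norm_pauli_coef. Qed.

Definition flipset (al : G -> pauli) : {set G} := [set i | flips (al i)].

Lemma matrix_element L (hL : (L <= n.+1)%N) (alpha : 'I_L -> pauli) b1 b2 p1 p2 :
  let al := ext_pauli alpha in
  braket (momentum_state b1 p1) (pauli_string hL alpha (momentum_state b2 p2)) =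
  (n.+1%:R)^-1 * \sum_j \sum_k (chi p1 j)^* * chi p2 k * string_coef al (rot b2 k) *
     (rot b1 j == flipmask (flipset al) (rot b2 k))%:R.
Proof.
move=> al; rewrite !momentum_stateE pauli_string_lcomb braket_lcomb mulr_sumr.
apply: eq_bigr => j _; rewrite mulr_sumr; apply: eq_bigr => k _.
(* Both vectors are written as one-term combinations, so that [braket_lcomb] extracts the
   coefficient and orthonormality leaves a Kronecker delta. *)
have -> : pauli_string hL alpha (product_state R (rot b2 k)) =
  lcomb (fun _ : 'I_1 => string_coef al (rot b2 k))
        (fun _ => product_state R (flipmask (flipset al) (rot b2 k))).
  apply/ffunP => s; rewrite pauli_string_product_state [RHS]ffunE big_ord1.
  congr (_ * product_state _ _ s); apply/ffunP => i.
  by rewrite [LHS]ffunE [RHS]ffunE inE.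
have -> : product_state R (rot b1 j) =
  lcomb (fun _ : 'I_1 => 1) (fun _ => product_state R (rot b1 j)).
  by apply/ffunP => s; rewrite [RHS]ffunE big_ord1 mul1r.
rewrite braket_lcomb !big_ord1 braket_product_state rmorph1 mul1r rmorphM /=.
have -> : Num.conj ((Num.sqrt (n.+1%:R : R))^-1)%:C = ((Num.sqrt (n.+1%:R : R))^-1)%:C.
  exact: conjc_real.
rewrite [X in X * _]mulrACA -rmorphM /= -invfM -expr2 sqr_sqrtr ?ler0n // fmorphV /= rmorph_nat.
by rewrite !mulrA.
Qed.

End MatrixElement.

(** * Estimates of the double sum *)

Section Bounds.
Variables (R : realType) (n : nat).
Local Notation G := 'I_n.+1.
Local Notation e := (unit_site n).
Implicit Types (b : {ffun G -> bool}) (i j k : G) (al : G -> pauli).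

Lemma norm_chi p j : `|chi (p : R) j| = 1.
Proof. exact: norm_expi. Qed.

Lemma norm_conj_chi p j : `|(chi (p : R) j)^*| = 1.
Proof. by rewrite /chi conj_expi norm_expi. Qed.

(** With no kink at the sites of sigma^x, a shift by one site reverses every sign read by the
    string, and there are oddly many of them. *)
Lemma string_coef_step al b : (forall i, al i \in [:: P0; Px]) ->
    odd #|[set i | al i == Px]| -> (forall i, al i = Px -> ~~ kink b i) ->
  string_coef R al (rot b e) = - string_coef R al b.
Proof.
move=> hal oddx nokink.
rewrite -mulN1r -[-1]expr1 -(_ : (-1) ^+ #|[set i | al i == Px]| = (-1) ^+ 1 :> R[i]); last first.
  by rewrite -signr_odd oddx.
rewrite -prodr_const big_mkcond /= /string_coef -big_split /=; apply: eq_bigr => i _.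
rewrite inE ffunE; have := hal i; rewrite !inE => /orP [] /eqP hi; rewrite hi /=.
  by rewrite mul1r.
by have := nokink _ hi; rewrite /kink; case: (b i); case: (b (i + e)) => //= _;
  rewrite ?mulr1 ?mulrNN ?mulr1.
Qed.

Lemma norm_diagonal_sum al b p1 p2 : odd n.+1 ->
    is_momentum n.+1 p1 -> is_momentum n.+1 p2 ->
    (forall i, al i \in [:: P0; Px]) -> odd #|[set i | al i == Px]| ->
  `|(1 + expi (p1 - p2)) * \sum_j \sum_k (chi p1 j)^* * chi p2 k *
      string_coef R al (rot b k) * (rot b j == rot b k)%:R|
  <= (2 * (#|[set i | al i == Px]| * kinks b * kinks b))%:R.
Proof.
move=> oddn hp1 hp2 hal oddx; set X := [set i | al i == Px].
pose t j k : R[i] := (chi p1 j)^* * chi p2 k * (rot b j == rot b k)%:R.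
pose a k := string_coef R al (rot b k).
have -> : \sum_j \sum_k (chi p1 j)^* * chi p2 k * string_coef R al (rot b k) *
    (rot b j == rot b k)%:R = \sum_j \sum_k t j k * a k.
  by apply: eq_bigr => j _; apply: eq_bigr => k _; rewrite /t /a mulrAC.
(* Moving both indices by one site preserves the delta [rot b j == rot b k] and produces the phase
   e^{i p1} e^{-i p2}. *)
have shift : \sum_j \sum_k t j k * a k =
    expi (p1 - p2) * \sum_j \sum_k t j k * a (k + e).
  rewrite (reindex_inj (addIr e)) /= mulr_sumr; apply: eq_bigr => j _.
  rewrite (reindex_inj (addIr e)) /= mulr_sumr; apply: eq_bigr => k _.
  have conj_unit : Num.conj (expi (- p1)) = expi p1.
    by rewrite -[in RHS](opprK p1); exact: conj_expi.
  by rewrite /t rot_shift !chiD // !chi_unit // rmorphM /= conj_unit expiD; ring.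
(* Only the term without the phase is shifted; the phase then factors out and leaves
   [a (k + e) + a k]. *)
rewrite mulrDl mul1r {1}shift -mulrDr normrM norm_expi mul1r -big_split /=.
have small k : `|a (k + e) + a k| <= (2 * \sum_(i in X) kink b (i + k)%R)%:R.
  have [allno|] := boolP [forall i in X, ~~ kink b (i + k)].
    rewrite /a -rotD string_coef_step ?addNr ?normr0 ?ler0n // => i hi.
    by rewrite kink_rot; apply: (forall_inP allno); rewrite inE hi.
  rewrite negb_forall_in => /exists_inP [i iX]; rewrite negbK => hi.
  apply: (@le_trans _ _ 2); last first.
    by rewrite ler_nat (bigD1 i) //= hi mulnDr leq_addr.
  by apply: le_trans (ler_normD _ _) _; rewrite !norm_string_coef.
have tnorm j k : `|t j k| = (rot b j == rot b k)%:R.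
  by rewrite !normrM norm_conj_chi norm_chi !mul1r normr_nat.
apply: le_trans (ler_norm_sum _ _ _) _.
apply: (@le_trans _ _ (\sum_j \sum_k
    ((rot b j == rot b k) * (2 * \sum_(i in X) kink b (i + k)%R))%:R)).
  apply: ler_sum => j _; rewrite -big_split /=; apply: le_trans (ler_norm_sum _ _ _) _.
  apply: ler_sum => k _; rewrite -mulrDr normrM tnorm natrM.
  by apply: ler_wpM2l; rewrite ?ler0n.
under eq_bigr => j _ do rewrite -natr_sum.
rewrite -natr_sum ler_nat exchange_big /=.
(* For fixed [k] at most [kinks b] values of [j] match; summing over [k] afterwards counts each site
   of [X] once per kink. *)
apply: (@leq_trans (\sum_k kinks b * (2 * \sum_(i in X) kink b (i + k)%R))%N).
  apply: leq_sum => k _; rewrite -big_distrl /= leq_mul2r; apply/orP; right.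
  apply: leq_trans (card_rot_eq b (rot b k) oddn).
  rewrite -sum1_card [leqRHS]big_mkcond /=; apply: leq_sum => j _.
  by rewrite inE; case: (_ == _).
rewrite -!big_distrr /= exchange_big /= mulnCA leq_mul2l /= mulnC leq_mul2r.
apply/orP; right; rewrite -sum1_card big_distrl /=; apply: leq_sum => i _.
rewrite mul1n -(card_kink_shift b i) -sum1_card [leqRHS]big_mkcond /=.
by apply: leq_sum => k _; rewrite inE; case: (kink _ _).
Qed.

(** A vanishing cosine would give e^{i(p1-p2)} = -1, whose N-th power is -1 for odd N, whereas
    momenta make it 1. *)
Lemma cos_momentum_neq0 (p1 p2 : R) : odd n.+1 ->
  is_momentum n.+1 p1 -> is_momentum n.+1 p2 -> cos ((p1 - p2) / 2) != 0.
Proof.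
move=> oddn hp1 hp2; apply/eqP => h.
have h1 : expi (p1 - p2) = -1.
  apply/eqP; rewrite -addr_eq0 addrC -normr_eq0 norm_1Dexpi h normr0 mulr0.
  by rewrite eqxx.
have expX m : expi ((p1 - p2) * m%:R) = expi (p1 - p2) ^+ m.
  elim: m => [|m IH]; first by rewrite mulr0 expi0 expr0.
  by rewrite mulrSr mulrDr (expiD (_ * _)) IH mulr1 exprSr.
have := expX n.+1; rewrite h1 -signr_odd oddn mulrBl expiD -conj_expi.
rewrite -[n.+1]muln1 !expi_momentum // rmorph1 mulr1 expr1 => /eqP.
by rewrite -addr_eq0 -mulr2n pnatr_eq0.
Qed.

(** All phases and string coefficients are unimodular, so the triangle inequality reduces the bound
    to counting matching pairs. *)
Lemma norm_matrix_element L (hL : (L <= n.+1)%N) (alpha : 'I_L -> pauli) b1 b2 (p1 p2 : R) :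
  `|braket (momentum_state b1 p1) (pauli_string hL alpha (momentum_state b2 p2))| <=
  (n.+1%:R)^-1 * (\sum_j \sum_k
    (rot b1 j == flipmask (flipset (ext_pauli alpha)) (rot b2 k)))%:R.
Proof.
rewrite matrix_element normrM ger0_norm ?invr_ge0 ?ler0n //.
apply: ler_wpM2l; rewrite ?invr_ge0 ?ler0n // natr_sum.
apply: le_trans (ler_norm_sum _ _ _) _; apply: ler_sum => j _; rewrite natr_sum.
apply: le_trans (ler_norm_sum _ _ _) _; apply: ler_sum => k _.
by rewrite !normrM norm_conj_chi norm_chi norm_string_coef !mul1r normr_nat.
Qed.

Lemma flipset_ltn L (alpha : 'I_L -> pauli) i :
  i \in flipset (ext_pauli alpha) -> (i < L)%N.
Proof. by rewrite inE /ext_pauli; case: insubP. Qed.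

Lemma card_string_pairs L (hL : (L <= n.+1)%N) (alpha : 'I_L -> pauli) b1 b2 :
    odd n.+1 -> (exists l, alpha l \in [:: Py; Pz]) ->
  (\sum_j \sum_k (rot b1 j == flipmask (flipset (ext_pauli alpha)) (rot b2 k))
   <= 2 * (kinks b1 * kinks b2) + L ^ 2)%N.
Proof.
move=> oddn [j0 hj0]; set S := flipset _.
have hS : widen_ord hL j0 \in S by rewrite inE ext_pauli_widen.
have := hL; rewrite leq_eqVlt => /orP [/eqP LN|ltL].
  apply: (@leq_trans (L ^ 2)%N); last exact: leq_addl.
  rewrite LN -mulnn -[X in (_ <= X * _)%N]card_ord -sum_nat_const.
  apply: leq_sum => j _; rewrite -[leqRHS]card_ord -sum1_card; apply: leq_sum => k _; exact: leq_b1.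
apply: leq_trans (leq_addr _ _).
(* The last flipped site [i] satisfies [i + 1 <= L < N], so its successor does not wrap around and,
   by maximality, is not flipped. *)
case: (@arg_maxnP _ (widen_ord hL j0) (fun i => i \in S) (@nat_of_ord _) hS) => i iS imax.
apply: (@card_flip_pairs _ _ _ _ i) => //; apply/negP => /imax.
have iL := flipset_ltn iS.
by rewrite -ordS_add /= modn_small ?ltnn // ltnS (leq_trans iL).
Qed.

Lemma transl_equiv_rot b1 b2 j k :
  rot b1 j = rot b2 k -> transl_equiv (product_state R b1) (product_state R b2).
Proof.
move=> h; exists (Posz (nat_of_ord (k - j))).
rewrite transl_pow_product_state valZpK; congr product_state.
by rewrite -rotD -h rotD addrN rot0.
Qed.

Lemma card_ext_pauli L (hL : (L <= n.+1)%N) (alpha : 'I_L -> pauli) :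
  #|[set i : G | ext_pauli alpha i == Px]| = #|[set l | alpha l == Px]|.
Proof.
have widen_inj : injective (widen_ord hL).
  by move=> i j /(congr1 val) /= h; apply: val_inj.
rewrite -(card_imset _ widen_inj); apply: eq_card => i; rewrite [LHS]inE.
apply/idP/imsetP => [|[j hj ->]]; last by move: hj; rewrite inE ext_pauli_widen.
rewrite /ext_pauli; case: insubP => // j _ hj h; exists j; rewrite ?inE //.
exact: val_inj.
Qed.

End Bounds.

Theorem theorem2 (R : realType) (L : nat) (hL : (1 <= L)%N) (n1 n2 : nat) :
  exists C1 C2 : R, 0 < C1 /\ 0 < C2 /\
  forall (N : nat) (hN : odd N) (hLN : (L <= N)%N)
    (alpha : 'I_L -> pauli) (beta1 beta2 : {ffun 'I_N -> bool}) (p1 p2 : R),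
  kinks beta1 = n1 -> kinks beta2 = n2 ->
  is_momentum N p1 -> is_momentum N p2 ->
  let psi1 := product_state R beta1 in
  let psi2 := product_state R beta2 in
  let M := braket (momentum_state beta1 p1)
             (pauli_string hLN alpha (momentum_state beta2 p2)) in
  ((forall j, alpha j \in [:: P0; Px]) ->
   odd #|[set j | alpha j == Px]| ->
     (psi1 <> psi2 -> ~ transl_equiv psi1 psi2 -> M = 0) /\
     (psi1 = psi2 ->
        `|M| <= (C1 / (N%:R * `|cos ((p1 - p2) / 2)|))%:C))
  /\
  ((exists j, alpha j \in [:: Py; Pz]) -> `|M| <= (C2 / N%:R)%:C).
Proof.
(* The successor in C1 keeps it positive even when [n1] is 0. C2 adds the bounds for [L < N] and
   [L = N]; its positivity comes from [L ^ 2]. *)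
exists (L * n1 * n1).+1%:R, (2 * (n1 * n2) + L ^ 2)%:R.
split; first by rewrite ltr0n.
split; first by rewrite ltr0n addn_gt0 expn_gt0 hL orbT.
case=> [//|n] hN hLN alpha b1 b2 p1 p2 k1 k2 hp1 hp2 /=; split; last first.
  move=> hflip; apply: le_trans (norm_matrix_element _ _ _ _ _ _) _.
  rewrite mulrC rmorphM fmorphV !rmorph_nat.
  apply: ler_wpM2r; rewrite ?invr_ge0 ?ler0n // ler_nat -k1 -k2.
  exact: card_string_pairs.
move=> hal oddx; set al := @ext_pauli n.+1 L alpha.
have hal' i : al i \in [:: P0; Px].
  by rewrite /al /ext_pauli; case: insubP => [j _ _|_].
have noflip b : flipmask (flipset al) b = b.
  apply/ffunP => i; rewrite ffunE inE /flips; have := hal' i.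
  by rewrite !inE => /orP [] /eqP ->; rewrite addbF.
split=> [_ neq|/product_state_inj eqb].
  (* Without flips a nonzero delta would make the two states translates of each other. *)
  rewrite matrix_element big1 ?mulr0 // => j _; rewrite big1 // => k _.
  rewrite noflip; case: eqP => [/transl_equiv_rot h|]; last by rewrite mulr0.
  by case: neq; exact: h.
rewrite matrix_element -/al; under eq_bigr => j _ do
  under eq_bigr => k _ do rewrite noflip.
rewrite -eqb in k2 *; set S := \sum_j _.
have c_gt0 : 0 < `|cos ((p1 - p2) / 2)|.
  by rewrite normr_gt0 (@cos_momentum_neq0 _ n).
have := @norm_diagonal_sum R n al b1 p1 p2 hN hp1 hp2 hal'.
rewrite (card_ext_pauli hLN) => /(_ oddx); rewrite -/S normrM norm_1Dexpi k1.
set c := `|cos _| in c_gt0 * => hS.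
rewrite normrM ger0_norm ?invr_ge0 ?ler0n //.
rewrite rmorphM fmorphV rmorphM /= !rmorph_nat invfM mulrCA.
apply: ler_wpM2l; rewrite ?invr_ge0 ?ler0n // ler_pdivlMr ?ltcR //.
(* The 2 in the modulus 2|cos((p1-p2)/2)| cancels the 2 of [norm_diagonal_sum]; the number of
   sigma^x is then bounded by [L]. *)
move: hS; rewrite rmorphM rmorph_nat -mulrA natrM ler_pM2l ?ltr0n // mulrC => hS.
apply: le_trans hS _; rewrite ler_nat; apply: leqW; rewrite !leq_mul //.
by rewrite -[leqRHS]card_ord max_card.
Qed.
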